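(* Let $q$ be a prime power. The following formulae hold. (i) For $n\geq 3$, \[N_{n,\mu(n)}(q)=(q-1)\,N_{n-2,\mu(n-2)}(q).\] (ii) For $n\geq 5$, \[N_{n,\mu(n)-1}(q)=(q-1)\,N_{n-2,\mu(n-2)-1}(q)+q(q-1)^2\,N_{n-4,\mu(n-4)}(q).\] (iii) For $n\geq 7$, \[N_{n,\mu(n)-2}(q)=(q-1)\,N_{n-2,\mu(n-2)-2}(q)+q(q-1)^2\,N_{n-4,\mu(n-4)-1}(q)+(2q^2+q-1)(q-1)^3\,N_{n-6,\mu(n-6)}(q).\]
   Context: For a prime power $q$ and an integer $n\ge 1$, $U_n(q)$ is the group of all upper triangular $n\times n$ matrices over the field $\mathbb{F}_q$ with $q$ elements whose diagonal entries all equal $1$. $N_{n,e}(q)$ denotes the number of complex irreducible characters of $U_n(q)$ of degree $q^e$. Put $\mu(n)=m(m-1)$ if $n=2m$ and $\mu(n)=m^2$ if $n=2m+1$; it is known that the degrees of the irreducible characters of $U_n(q)$ are precisely the numbers $q^e$ with $0\le e\le \mu(n)$. *)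

(* Defs.v *)
From HB Require Import structures.
From mathcomp Require Import all_boot all_order all_algebra all_fingroup.
From mathcomp Require Import all_solvable all_field all_character.

Set Implicit Arguments.
Unset Strict Implicit.
Unset Printing Implicit Defensive.

Import GroupScope GRing.Theory.

(* [is_trig_mx] means lower triangular, hence the transpose. The elements of
   {'GL_n[F]} are matrices of size n.-1.+1, so only n >= 1 is meaningful. *)
Definition unitriangular (n : nat) (F : finFieldType) : {set {'GL_n[F]}} :=
  [set u | is_trig_mx (GLval u)^T%R
           & [forall i, GLval u i i == 1%R]].

Lemma unitriangular_group_set n (F : finFieldType) :
  group_set (unitriangular n F).
Proof.
apply/group_setP; split=> [|u v].
  rewrite inE; apply/andP; split.
    by rewrite GL_1E trmx1; exact: scalar_mx_is_trig.
  by apply/forallP=> i; rewrite GL_1E mxE eqxx.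
rewrite !inE => /andP[/is_trig_mxP tu /forallP du].
case/andP=> /is_trig_mxP tv /forallP dv.
have Zu (i j : 'I_n.-1.+1) : (j < i)%N -> GLval u i j = 0%R.
  by move=> ji; have := tu _ _ ji; rewrite mxE.
have Zv (i j : 'I_n.-1.+1) : (j < i)%N -> GLval v i j = 0%R.
  by move=> ji; have := tv _ _ ji; rewrite mxE.
apply/andP; split.
  apply/is_trig_mxP=> j i ji; rewrite mxE GL_ME mxE big1 // => k _.
  case: (ltnP k i) => [/Zu->|ik]; first by rewrite mul0r.
  by rewrite (Zv k j) ?mulr0 // (leq_trans ji).
apply/forallP=> i; rewrite GL_ME mxE (bigD1 i) //= (eqP (du i)) (eqP (dv i)).
rewrite mul1r big1 ?addr0 // => k; rewrite -val_eqE /= neq_ltn.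
by case/orP=> [/Zu->|/Zv->]; rewrite ?mul0r ?mulr0.
Qed.

Canonical unitriangular_group n F := Group (unitriangular_group_set n F).

Definition mu (n : nat) : nat :=
  if odd n then (n./2 ^ 2)%N else (n./2 * (n./2 - 1))%N.

Definition num_irr (n e : nat) (F : finFieldType) : nat :=
  #|[set i : Iirr (unitriangular n F)
     | ('chi_i 1%g == ((#|F| ^ e)%N)%:R)%R]|.

(* Main.v *)
Require Import Defs.
From HB Require Import structures.
From mathcomp Require Import all_boot all_order all_algebra all_fingroup.
From mathcomp Require Import all_solvable all_field all_character.
From mathcomp Require Import zify.

Set Implicit Arguments.
Unset Strict Implicit.
Unset Printing Implicit Defensive.

Import Order.TTheory GroupScope GRing.Theory Num.Theory.

(** Write U_n for the unitriangular group, with rows and columns numbered from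
    0, and q for #|F|. The last column of U_n is an abelian normal subgroup with
    quotient U_(n-1); its characters are the rows a of length n - 1 (compose
    v |-> a v with a nontrivial additive character of F), and U_(n-1) acts on
    them by right multiplication. Each such character extends to its inertia
    group, so by Clifford and Gallagher the irreducible characters of U_n above
    a correspond to those of the stabiliser of a in U_(n-1), the degree being
    multiplied by the length of the orbit of a. Weighting every a by the inverse
    of its orbit length counts the characters of a given degree
    ([irr_count_ext]).

    Up to a scalar, a nonzero row with leading coordinate t lies in the orbit of
    the basis row e_t, whose orbit under U_(n-1) has length q^(n-2-t). The
    stabiliser of e_t consists of the matrices with trivial row t: it is
    U_(n-2) extended by a column of height t ([stab_basis_row_ext]), hence a
    group of the same kind, with a shorter column. The counting theorem is
    therefore stated for an extension of a group L <= U_k by a column of height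
    s, and can be applied again ([irr_count_ext_lead]).

    Only few t matter for large degrees. A block of ceil(n/2) rows in the upper
    right corner is an abelian subgroup of U_n of index q^(mu n), and together
    with part of the added column it bounds the degrees of the stabilisers
    ([degrees_le_ext]). As a result the characters of degree q^(mu n - j) of U_n
    come from t <= j only ([irr_count_top]).

    - For t = 0 the column is empty: this is U_(n-2) and gives the first term of
      each formula.
    - For t = 1 the column is a central factor F: the count is q times the one of
      U_(n-2).
    - For t = 2 the count is q times the one of U_(n-2) plus q - 1 times a count
      for the subgroup of U_(n-2) defined by the vanishing of the entry (0, 1).
      The latter is normal in U_(n-2); one more application of
      [irr_count_ext_lead], to its last column, gives (q - 1)(q + 1) times the
      number of characters of U_(n-4) of largest degree
      ([irr_count_unitri_no01]).

    Adding these up and using (i) for U_(n-2) and U_(n-4), and (ii) for U_(n-2),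
    gives the three formulas. *)

Local Open Scope ring_scope.
Local Open Scope group_scope.
Local Open Scope nat_scope.

(** * Counting irreducible characters by degree *)

(** The factor c is there because the characters of an inertia group T are
    counted by the degree |G : T| chi(1) of the character that they induce. *)
Definition irr_count (gT : finGroupType) (G : {group gT}) (c d : nat) : nat :=
  #|[set i : Iirr G | ('chi_i 1%g * c%:R == d%:R)%R]|.

Section CliffordCount.
Variables (gT : finGroupType) (G V : {group gT}).
Hypothesis nsVG : V <| G.
Hypothesis abV : abelian V.

(** By Gallagher the characters of the inertia group above an extendible linear
    character are its extension times the characters of the quotient, and by
    Clifford they induce bijectively to the characters of G above it. *)
Lemma count_above_inertia (t : Iirr V) (c : Iirr 'I_G['chi_t]) (d : nat) :
    'Res[V] 'chi_c = 'chi_t ->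
  #|[set i in irr_constt ('Ind[G] 'chi_t) | ('chi_i 1%g == d%:R)%R]| =
  irr_count ('I_G['chi_t] / V) #|G : 'I_G['chi_t]| d.
Proof.
move=> Res_c; set T := 'I_G['chi_t]%G.
have nsVT : V <| T by apply: normal_Inertia; apply: normal_sub.
have [irrM injM imM _] := constt_Ind_ext nsVT Res_c.
have [irrI injI imI _ _] := constt_Inertia_bijection t nsVG.
have memM (b : Iirr (T / V)) : mul_mod_Iirr c b \in irr_constt ('Ind[T] 'chi_t).
  by rewrite imM; exact: codom_f.
pose f (b : Iirr (T / V)) := Ind_Iirr G (mul_mod_Iirr c b).
have injf : injective f by move=> b b' /injI/injM; apply; apply: memM.
have c1 : ('chi_c 1%g = 1)%R.
  by rewrite -(cfRes1 V) Res_c lin_char1 //; apply/char_abelianP.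
have f1 b : ('chi_(f b) 1%g = 'chi_b 1%g * #|G : T|%:R)%R.
  rewrite cfIirrE; last by apply: irrI; exact: memM.
  rewrite cfInd1 ?subsetIl // cfIirrE; last exact: irrM.
  by rewrite cfunE c1 mulr1 mod_IirrE // cfMod1 mulrC.
rewrite /irr_count -(card_imset _ injf); apply: eq_card => i.
rewrite inE; apply/andP/imsetP => [[]|[b + ->]]; last first.
  rewrite inE -f1 => ->; split => //.
  by rewrite -imI; apply/imset_f/memM.
rewrite -imI => /imsetP[j]; rewrite imM => /codomP[b ->] -> Hd.
by exists b => //; rewrite inE -f1.
Qed.

(** A character of G lies above exactly one G-orbit of characters of V. Giving the
    weight |'I_G[chi_t]| = |G| / |orbit| to each t avoids the choice of orbit
    representatives. *)
Lemma little_group_count (d : nat) :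
    (forall t : Iirr V, exists c : Iirr 'I_G['chi_t], 'Res[V] 'chi_c = 'chi_t) ->
  #|G| * irr_count G 1 d =
  \sum_(t : Iirr V)
     #|'I_G['chi_t]| * irr_count ('I_G['chi_t] / V) #|G : 'I_G['chi_t]| d.
Proof.
move=> ext.
pose D := [pred i : Iirr G | ('chi_i 1%g == d%:R)%R].
have orb (i : Iirr G) :
    \sum_(t : Iirr V | t \in irr_constt ('Res[V] 'chi_i)) #|'I_G['chi_t]| = #|G|.
  have [t0 t0i] := neq0_has_constt (Res_irr_neq0 V i).
  have memE (t : Iirr V) :
      (t \in irr_constt ('Res[V] 'chi_i)) = (t \in cfclass_Iirr G t0).
    rewrite cfclass_IirrE // irr_consttE (Clifford_Res_sum_cfclass nsVG t0i).
    rewrite reindex_cfclass // cfdotZl cfdot_suml mulf_eq0.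
    move: (t0i); rewrite irr_consttE => /negPf-> /=.
    rewrite big_mkcond (bigD1 t) //= big1 ?addr0.
      by case: ifP; rewrite ?cfnorm_irr ?oner_eq0 ?eqxx.
    by move=> k kt; case: ifP => // _; rewrite cfdot_irr (negPf kt).
  rewrite (eq_bigl _ _ memE) (eq_bigr (fun=> #|'I_G['chi_t0]|)).
    by rewrite sum_nat_const card_cfclass_Iirr // mulnC Lagrange ?subsetIl.
  move=> t /imsetP[y Gy ->]; rewrite conjg_IirrE.
  have nVy : y \in 'N(V) by apply: (subsetP (normal_norm nsVG)).
  by rewrite -(conjg_inertia _ nVy) -{1}(conjGid Gy) -conjIg cardJg.
transitivity (\sum_(i : Iirr G | D i)
   \sum_(t : Iirr V | t \in irr_constt ('Res[V] 'chi_i)) #|'I_G['chi_t]|).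
  rewrite (eq_bigr (fun=> #|G|)) // sum_nat_const mulnC; congr (_ * _).
  by apply: eq_card => i; rewrite !inE mulr1.
rewrite (exchange_big_dep predT) //=; apply: eq_bigr => t _.
have [c Rc] := ext t.
rewrite -(count_above_inertia _ Rc) sum_nat_const mulnC; congr (_ * _).
by apply: eq_card => i; rewrite [in RHS]inE constt_Ind_Res andbC.
Qed.
End CliffordCount.

Lemma irr_count_isog (gT rT : finGroupType) (G : {group gT}) (H : {group rT}) c d :
  G \isog H -> irr_count G c d = irr_count H c d.
Proof.
case/isogP => f injf fG.
have isof : isom G H f by apply/isomP.
rewrite /irr_count -(card_imset _ (isom_Iirr_inj isof)).
apply: eq_card => i; rewrite inE; apply/imsetP/idP => [[j + ->]|Hi].
  by rewrite inE isom_IirrE cfIsom1.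
exists (isom_Iirr (isom_sym isof) i); last by rewrite isom_IirrKV.
by rewrite inE isom_IirrE cfIsom1.
Qed.

Definition degrees_le (gT : finGroupType) (G : {group gT}) (B : nat) :=
  forall i : Iirr G, ('chi_i 1%g <= B%:R)%R.

Lemma irr_degree_nat (gT : finGroupType) (G : {group gT}) (i : Iirr G) :
  exists2 m : nat, (0 < m)%N & ('chi_i 1%g = m%:R)%R.
Proof.
have /natrP[m Hm] := Cnat_irr1 i; exists m => //.
by have := irr1_gt0 i; rewrite Hm ltr0n.
Qed.

(** Every irreducible character of G is a constituent of a character induced from
    a linear character of A. *)
Lemma degrees_le_index_abelian (gT : finGroupType) (A G : {group gT}) :
  A \subset G -> abelian A -> degrees_le G #|G : A|.
Proof.
move=> sAG abA i; have [t t_i] := neq0_has_constt (Res_irr_neq0 A i).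
have: i \in irr_constt ('Ind[G] 'chi_t) by rewrite constt_Ind_Res.
case/constt_charP => [|psi psi_char Dpsi]; first by rewrite cfInd_char ?irr_char.
have -> : (#|G : A|%:R = 'Ind[G] 'chi_t 1%g)%R.
  by rewrite cfInd1 // lin_char1 ?mulr1 //; apply/char_abelianP.
by rewrite Dpsi cfunE lerDl char1_ge0.
Qed.

(** Every irreducible character of H is a constituent of the restriction of one of
    G. *)
Lemma degrees_le_sub (gT : finGroupType) (H G : {group gT}) B :
  H \subset G -> degrees_le G B -> degrees_le H B.
Proof.
move=> sHG leB j.
have [i j_i] := constt_cfInd_irr j sHG.
move: j_i; rewrite constt_Ind_Res.
case/constt_charP => [|psi psi_char Dpsi]; first by rewrite cfRes_char ?irr_char.
apply: le_trans (leB i); rewrite -(cfRes1 H 'chi_i) Dpsi cfunE lerDl.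
exact: char1_ge0.
Qed.

Lemma irr_count_eq0 (gT : finGroupType) (G : {group gT}) B c d :
  degrees_le G B -> (B * c < d)%N -> irr_count G c d = 0.
Proof.
move=> leB ltd; apply: eq_card0 => i; rewrite inE; apply/negbTE.
have [m _ Hm] := irr_degree_nat i.
rewrite Hm -natrM eqr_nat neq_ltn; apply/orP; left; apply: leq_ltn_trans ltd.
by have := leB i; rewrite Hm ler_nat leq_mul2r orbC => ->.
Qed.

Lemma irr_countM (gT : finGroupType) (G : {group gT}) c d :
  (0 < c)%N -> irr_count G c (d * c) = irr_count G 1 d.
Proof.
move=> c0; apply: eq_card => i; rewrite !inE.
have [m _ Hm] := irr_degree_nat i.
by rewrite Hm -!natrM !eqr_nat muln1 eqn_pmul2r.
Qed.

Local Open Scope group_scope.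
Local Open Scope ring_scope.

(** * Deletion of a row and a column *)

(** The index is shifted by one, because [{'GL_n[F]}] consists of matrices of size
    n.-1.+1. *)
Notation unitri F k := (unitriangular_group k.+1 F).
Notation basis_row t := (delta_mx 0 t).

Section MatrixDeletion.
Variables (F : finFieldType) (k : nat) (r : 'I_k.+2).
Implicit Types (M N : 'M[F]_k.+2) (A B : 'M[F]_k.+1) (v : 'cV[F]_k.+1).

Definition row_trivial M := row r M == delta_mx 0 r.
Definition del M : 'M[F]_k.+1 := row' r (col' r M).
Definition delcol M : 'cV[F]_k.+1 := row' r (col r M).
Definition ins v A : 'M[F]_k.+2 :=
  \matrix_(i, j) match unlift r i, unlift r j with
                 | None, None => 1
                 | None, Some _ => 0
                 | Some i', None => v i' 0
                 | Some i', Some j' => A i' j'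
                 end.

Lemma row_trivialP M : reflect (forall j, M r j = (j == r)%:R) (row_trivial M).
Proof.
apply: (iffP eqP) => [/rowP eM j|eM].
  by have := eM j; rewrite !mxE /=.
by apply/rowP => j; rewrite !mxE eM.
Qed.

Lemma row_trivial1 : row_trivial 1%:M.
Proof. by apply/row_trivialP => j; rewrite mxE eq_sym. Qed.

Lemma row_trivialM M N : row_trivial M -> row_trivial (M *m N) = row_trivial N.
Proof. by rewrite /row_trivial => /eqP tM; rewrite row_mul tM -rowE. Qed.

Lemma del1 : del 1%:M = 1%:M.
Proof. by apply/matrixP => i j; rewrite !mxE (inj_eq lift_inj). Qed.

Lemma delcol1 : delcol 1%:M = 0.
Proof. by apply/colP => i; rewrite !mxE eq_sym (negPf (neq_lift _ _)). Qed.

(** Row r of N is trivial, so the term of index r disappears from the product. *)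
Lemma delM M N : row_trivial N -> del (M *m N) = del M *m del N.
Proof.
move=> /row_trivialP tN; apply/matrixP => i j; rewrite !mxE (bigD1_ord r) //=.
rewrite tN eq_sym (negPf (neq_lift _ _)) mulr0 add0r.
by apply: eq_bigr => l _; rewrite !mxE.
Qed.

Lemma delcolM M N :
  row_trivial N -> delcol (M *m N) = delcol M + del M *m delcol N.
Proof.
move=> /row_trivialP tN; apply/colP => i; rewrite !mxE (bigD1_ord r) //=.
rewrite tN eqxx mulr1; congr (_ + _).
by apply: eq_bigr => l _; rewrite !mxE.
Qed.

Lemma ins_row_trivial v A : row_trivial (ins v A).
Proof.
apply/row_trivialP => j; rewrite mxE unlift_none.
by case: unliftP => [j'|] ->; rewrite ?eqxx // eq_sym (negPf (neq_lift _ _)).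
Qed.

Lemma del_ins v A : del (ins v A) = A.
Proof. by apply/matrixP => i j; rewrite !mxE !liftK. Qed.

Lemma delcol_ins v A : delcol (ins v A) = v.
Proof. by apply/colP => i; rewrite !mxE liftK unlift_none. Qed.

Lemma del_ext M N : row_trivial M -> row_trivial N ->
  del M = del N -> delcol M = delcol N -> M = N.
Proof.
move=> /row_trivialP tM /row_trivialP tN /matrixP eA /colP ev.
apply/matrixP => i j; case: (unliftP r i) => [i'|] ->; last by rewrite tM tN.
case: (unliftP r j) => [j'|] ->.
  by have := eA i' j'; rewrite !mxE.
by have := ev i'; rewrite !mxE.
Qed.

Lemma ins_unitmx v A : A \in unitmx -> ins v A \in unitmx.
Proof.
move=> uA; suff: ins v A *m ins (- (invmx A *m v)) (invmx A) = 1%:M.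
  by case/mulmx1_unit.
apply: del_ext; rewrite ?row_trivial1 ?row_trivialM ?ins_row_trivial //.
  by rewrite delM ?ins_row_trivial // !del_ins mulmxV // del1.
rewrite delcolM ?ins_row_trivial // !delcol_ins del_ins delcol1.
by rewrite mulmxN mulmxA mulmxV // mul1mx subrr.
Qed.

End MatrixDeletion.

Lemma GLvalM (F : finFieldType) (k : nat) (M N : {'GL_k.+1[F]}) :
  GLval (M * N)%g = (GLval M : 'M[F]_k.+1) *m (GLval N : 'M[F]_k.+1).
Proof. by []. Qed.

Lemma card_rV_family (F : finFieldType) n (D : 'I_n -> {set F}) :
  #|[set a : 'rV[F]_n | [forall i, a 0 i \in D i]]| = (\prod_i #|D i|)%N.
Proof.
have inj : injective (fun f : {ffun 'I_n -> F} => \row_i f i).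
  by move=> f g /rowP eq_fg; apply/ffunP => i; have := eq_fg i; rewrite !mxE.
transitivity #|family (fun i => mem (D i))|; last first.
  rewrite card_family foldrE big_image /=.
  by apply: eq_bigr.
rewrite -(card_image inj); apply: eq_card => a.
rewrite inE; apply/forallP/imageP => [Da|[f Df ->] i].
  exists [ffun i => a 0 i]; last by apply/rowP => i; rewrite mxE ffunE.
  by apply/familyP => i; rewrite ffunE; exact: Da.
by rewrite mxE; exact: (familyP Df).
Qed.

Lemma card_cV_family (F : finFieldType) n (D : 'I_n -> {set F}) :
  #|[set v : 'cV[F]_n | [forall i, v i 0 \in D i]]| = (\prod_i #|D i|)%N.
Proof.
rewrite -card_rV_family -(card_imset _ (@trmx_inj F n 1)).
apply: eq_card => a; rewrite inE; apply/imsetP/forallP => [[v Dv ->] i|Da].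
  by rewrite mxE; move: Dv; rewrite inE => /forallP.
exists a^T; last by rewrite trmxK.
by rewrite inE; apply/forallP => i; rewrite mxE.
Qed.

(** * Unitriangular matrices acting on truncated rows *)

Section UnitriangularAction.
Variables (F : finFieldType) (k : nat).
Implicit Types (A B : {'GL_k.+1[F]}).

Local Notation U := (unitri F k).

Lemma unitriangularP A :
  reflect ((forall i j : 'I_k.+1, (j < i)%N -> GLval A i j = 0)
           /\ (forall i, GLval A i i = 1)) (A \in U).
Proof.
rewrite inE; apply: (iffP andP) => [[/is_trig_mxP tA /forallP dA]|[tA dA]].
  split=> [i j ltji|i]; last exact/eqP.
  by have := tA j i ltji; rewrite mxE.
split; last by apply/forallP => i; apply/eqP.
by apply/is_trig_mxP => i j ltij; rewrite mxE tA.
Qed.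

Definition colsupp (s : nat) (v : 'cV[F]_k.+1) :=
  [forall i : 'I_k.+1, (s <= i)%N ==> (v i 0 == 0)].

Lemma colsuppP s (v : 'cV[F]_k.+1) :
  reflect (forall i : 'I_k.+1, (s <= i)%N -> v i 0 = 0) (colsupp s v).
Proof.
apply: (iffP forallP) => [H i si|H i]; first exact/eqP/(implyP (H i)).
by apply/implyP => si; apply/eqP/H.
Qed.

Lemma colsupp0 s : colsupp s 0.
Proof. by apply/colsuppP => i _; rewrite mxE. Qed.

Lemma colsuppD s (v w : 'cV[F]_k.+1) :
  colsupp s v -> colsupp s w -> colsupp s (v + w).
Proof.
move=> /colsuppP Hv /colsuppP Hw; apply/colsuppP => i si.
by rewrite mxE Hv // Hw // addr0.
Qed.

Lemma colsupp_mul s A (v : 'cV[F]_k.+1) :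
  A \in U -> colsupp s v -> colsupp s (GLval A *m v).
Proof.
move=> /unitriangularP[tA _] /colsuppP Hv; apply/colsuppP => i si.
rewrite mxE big1 // => j _; have [ltji|leij] := ltnP j i.
  by rewrite tA ?mul0r.
by rewrite Hv ?mulr0 // (leq_trans si).
Qed.

(** The row a stands for the functional v |-> a v on the columns supported on the
    first s coordinates; only its first s coordinates count. *)
Definition stab_set (s : nat) (a : 'rV[F]_k.+1) : {set {'GL_k.+1[F]}} :=
  [set A in U | [forall j : 'I_k.+1, (j < s)%N ==> ((a *m GLval A) 0 j == a 0 j)]].

Lemma stabP s (a : 'rV[F]_k.+1) A :
  reflect (A \in U /\ forall j : 'I_k.+1, (j < s)%N -> (a *m GLval A) 0 j = a 0 j)
    (A \in stab_set s a).
Proof.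
apply: (iffP setIdP) => [[UA /forallP H]|[UA H]]; split=> //.
  by move=> j js; exact/eqP/(implyP (H j)).
by apply/forallP => j; apply/implyP => js; rewrite H.
Qed.

(** An upper triangular matrix does not move later coordinates of a row into earlier
    ones. *)
Lemma unitri_trunc s (a b : 'rV[F]_k.+1) A : A \in U ->
  (forall j : 'I_k.+1, (j < s)%N -> a 0 j = b 0 j) ->
  forall j : 'I_k.+1, (j < s)%N -> (a *m GLval A) 0 j = (b *m GLval A) 0 j.
Proof.
move=> /unitriangularP[tA _] eab j js; rewrite !mxE; apply: eq_bigr => l _.
have [ltjl|lelj] := ltnP j l; first by rewrite tA ?mulr0.
by rewrite eab // (leq_ltn_trans lelj).
Qed.

Lemma stab_group_set s a : group_set (stab_set s a).
Proof.
apply/group_setP; split.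
  apply/stabP; split; first exact: group1.
  by move=> j _; rewrite GL_1E mulmx1.
move=> A B /stabP[UA sA] /stabP[UB sB]; apply/stabP; split; first exact: groupM.
by move=> j js; rewrite GLvalM mulmxA (unitri_trunc UB sA) // sB.
Qed.
Canonical stab s a := Group (stab_group_set s a).

Lemma stab_sub s a : stab s a \subset U.
Proof. by apply/subsetP => A /stabP[]. Qed.

End UnitriangularAction.

(** * Extension by a column of height s *)

Section ColumnExtension.
Variables (F : finFieldType) (k : nat) (r : 'I_k.+2) (s : nat).
Implicit Types (M N : {'GL_k.+2[F]}) (A B : {'GL_k.+1[F]}).
Local Notation U := (unitri F k).

Definition delGL M : {'GL_k.+1[F]} :=
  insubd (1%g : {'GL_k.+1[F]}) (del r (GLval M)).
Definition insGL (p : 'cV[F]_k.+1 * {'GL_k.+1[F]}) : {'GL_k.+2[F]} :=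
  insubd (1%g : {'GL_k.+2[F]}) (ins r p.1 (GLval p.2)).

Lemma delGLE M : row_trivial r (GLval M) -> GLval (delGL M) = del r (GLval M).
Proof.
move=> tM; rewrite /delGL insubdK //.
have tM' : row_trivial r (GLval M^-1%g).
  by rewrite -(row_trivialM _ tM) -[_ *m _]GLvalM mulgV row_trivial1.
have : del r (GLval M) *m del r (GLval M^-1%g) = 1%:M.
  by rewrite -delM // -[GLval M *m _]GLvalM mulgV GL_1E del1.
by case/mulmx1_unit.
Qed.

Lemma insGLE p : GLval (insGL p) = ins r p.1 (GLval p.2).
Proof. by rewrite /insGL insubdK //; exact: ins_unitmx (GL_unitmx p.2). Qed.

Lemma row_trivial_mul M N : row_trivial r (GLval M) ->
  row_trivial r (GLval (M * N)%g) = row_trivial r (GLval N).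
Proof. by rewrite GLvalM; exact: row_trivialM. Qed.

Lemma delGLM M N : row_trivial r (GLval M) -> row_trivial r (GLval N) ->
  delGL (M * N)%g = (delGL M * delGL N)%g.
Proof.
move=> tM tN; apply: val_inj; rewrite [LHS]delGLE ?row_trivial_mul //.
by rewrite [RHS]GLvalM !delGLE // -delM.
Qed.

(** The largest column extension. Every other one is a preimage in it under the
    deletion morphism, which makes its group structure and its quotients
    immediate. *)
Definition ambient_set : {set {'GL_k.+2[F]}} :=
  [set M : {'GL_k.+2[F]} | [&& row_trivial r (GLval M), colsupp s (delcol r (GLval M))
             & delGL M \in U]].

Lemma ambientP M :
  reflect [/\ row_trivial r (GLval M), colsupp s (delcol r (GLval M))
             & delGL M \in U] (M \in ambient_set).
Proof. by rewrite [M \in _]in_set; exact: and3P. Qed.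

Lemma ambient_group_set : group_set ambient_set.
Proof.
apply/group_setP; split.
  have t1 : row_trivial r (GLval (1%g : {'GL_k.+2[F]})) by exact: row_trivial1.
  apply/ambientP; split=> //; first by rewrite GL_1E delcol1 colsupp0.
  suff -> : delGL 1 = 1%g by exact: group1.
  by apply: val_inj; rewrite [LHS]delGLE // del1.
move=> M N /ambientP[tM sM uM] /ambientP[tN sN uN]; apply/ambientP.
rewrite row_trivial_mul // delGLM // groupM // GLvalM delcolM // -delGLE //.
by split=> //; rewrite colsuppD // colsupp_mul.
Qed.
Canonical ambient := Group ambient_group_set.

Lemma delGL_morphic : {in ambient &, {morph delGL : M N / (M * N)%g}}.
Proof. by move=> M N /ambientP[tM _ _] /ambientP[tN _ _]; exact: delGLM. Qed.
Canonical delGL_morphism := Morphism delGL_morphic.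

Lemma delGL_ins p : delGL (insGL p) = p.2.
Proof.
by apply: val_inj; rewrite [LHS]delGLE insGLE ?del_ins ?ins_row_trivial.
Qed.

Lemma insGL_ambient p : colsupp s p.1 -> p.2 \in U -> insGL p \in ambient.
Proof.
move=> sp up; apply/ambientP; rewrite delGL_ins insGLE delcol_ins.
by split=> //; exact: ins_row_trivial.
Qed.

Lemma insGL_del M : row_trivial r (GLval M) ->
  insGL (delcol r (GLval M), delGL M) = M.
Proof.
move=> tM; apply: val_inj; rewrite [LHS]insGLE /= delGLE //.
by apply: (del_ext (r := r)); rewrite ?ins_row_trivial ?del_ins ?delcol_ins.
Qed.

Lemma im_delGL : delGL @* ambient = U.
Proof.
apply/eqP; rewrite eqEsubset; apply/andP; split; apply/subsetP => A.
  by case/morphimP => M _ /ambientP[_ _ UM] ->.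
move=> UA; suff: delGL (insGL (0, A)) \in delGL @* ambient by rewrite delGL_ins.
apply: mem_morphim.
  by apply: insGL_ambient; rewrite ?colsupp0.
by apply: insGL_ambient; rewrite ?colsupp0.
Qed.

(** L extended by a column of height s: the column sits in position r, and its
    action is that of L on the first s coordinates. Up to isomorphism the group
    does not depend on r; the position serves to recognise such groups inside
    unitriangular groups. *)
Definition ext_group (L : {set {'GL_k.+1[F]}}) := delGL @*^-1 L.
Canonical ext_group_group (L : {group {'GL_k.+1[F]}}) := [group of ext_group L].

Lemma ext_groupP (L : {group {'GL_k.+1[F]}}) M : L \subset U ->
  reflect [/\ row_trivial r (GLval M), colsupp s (delcol r (GLval M))
             & delGL M \in L] (M \in ext_group L).
Proof.
move=> sLU; apply: (iffP morphpreP) => [[/ambientP[tM sM _] LM]|[tM sM LM]] //.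
by split=> //; apply/ambientP; split=> //; apply: (subsetP sLU).
Qed.

Lemma card_colsupp : (s <= k.+1)%N -> 
  #|[set v : 'cV[F]_k.+1 | colsupp s v]| = (#|F| ^ s)%N.
Proof.
move=> sk.
pose D (i : nat) : {set F} := if (i < s)%N then setT else [set 0].
transitivity #|[set v : 'cV[F]_k.+1 | [forall i : 'I_k.+1, v i 0 \in D i]]|.
  apply: eq_card => v; rewrite !inE; apply: eq_forallb => i.
  by rewrite /D; case: ltnP => _; rewrite ?in_setT ?in_set1.
rewrite card_cV_family -(big_mkord xpredT (fun i => #|D i|)).
rewrite (@big_cat_nat _ _ _ s) //= [X in (_ * X)%N]big_nat_cond.
rewrite [X in (_ * X)%N]big1 ?muln1 => [|i /andP[/andP[si _] _]]; last first.
  by rewrite /D ltnNge si /= cards1.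
rewrite big_nat_cond (eq_bigr (fun=> #|F|)); last first.
  by move=> i /andP[/andP[_ lti] _]; rewrite /D lti cardsT.
by rewrite -big_nat_cond prod_nat_const_nat subn0.
Qed.

Lemma card_ker_delGL : (s <= k.+1)%N -> #|'ker delGL| = (#|F| ^ s)%N.
Proof.
move=> sk; rewrite -card_colsupp //.
have inj : injective (fun v : 'cV[F]_k.+1 => insGL (v, 1%g)).
  move=> v w /(congr1 (fun M => delcol r (GLval M))).
  by rewrite !insGLE !delcol_ins.
rewrite -(card_imset _ inj); apply: eq_card => M.
apply/idP/imsetP => [|[v + ->]].
  case/morphpreP=> /ambientP[tM sM _] /set1P d1.
  by exists (delcol r (GLval M)); rewrite ?inE // -d1 insGL_del.
rewrite inE => sv; apply/kerP; last exact: delGL_ins.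
by apply: insGL_ambient; rewrite //= group1.
Qed.

Lemma card_ext (L : {group {'GL_k.+1[F]}}) : L \subset U -> (s <= k.+1)%N ->
  #|ext_group L| = (#|F| ^ s * #|L|)%N.
Proof.
move=> sLU sk; rewrite card_morphpre ?card_ker_delGL //.
by apply: subset_trans sLU _; rewrite -im_delGL.
Qed.

End ColumnExtension.

(** * Characters of the column and their stabilisers *)

Section AdditiveCharacter.
Variable F : finFieldType.

Lemma additive_character_exists : exists p : Iirr [set: F], p != 0.
Proof.
apply/existsP; rewrite -[[exists _, _]]negbK negb_exists; apply/negP => /forallP H.
have : (1 < #|Iirr [set: F]|)%N.
  rewrite card_Iirr_abelian; last exact: FinRing.zmod_abelian.
  by rewrite /= cardsT card_finNzRing_gt1.
rewrite (eq_card (B := pred1 (0 : Iirr [set: F]))); first by rewrite card1.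
by move=> i; have := H i; rewrite negbK !inE => ->.
Qed.

(** Characters are built from additive maps to F, so that an extension to a larger
    group only requires an extension of the additive map. *)
Lemma pullback_additive_char (gT : finGroupType) (T : {group gT}) (h : gT -> F)
    (p : Iirr [set: F]) :
    {in T &, forall x y, h (x * y)%g = h x + h y} ->
  exists c : Iirr T, {in T, forall x, 'chi_c x = 'chi_p (h x)}.
Proof.
move=> hM.
have hM' : {in T &, {morph h : x y / (x * y)%g >-> (x * y)%g}} by exact: hM.
pose f := Morphism hM'.
have lp : 'chi_p \is a linear_char.
  by apply/char_abelianP; rewrite FinRing.zmod_abelian.
have lc : cfMorph ('Res[f @* T] 'chi_p) \is a linear_char.
  by rewrite cfMorph_lin_char // cfRes_lin_char.
have /irrP[c Dc] := lin_char_irr lc.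
exists c => x Tx; rewrite -Dc cfMorphE // cfResE ?subsetT //.
exact: mem_morphim.
Qed.

(** The multiples of a nonzero b exhaust F. *)
Lemma additive_char_sep (p : Iirr [set: F]) (b : F) :
  p != 0 -> (forall y, 'chi_p (b * y) = 1) -> b = 0.
Proof.
move=> p0 H; apply: contraNeq p0 => b0; rewrite -irr_eq1; apply/eqP/cfunP => y.
by rewrite cfun1E inE -[RHS](H (b^-1 * y)) mulrA divff // mul1r.
Qed.
End AdditiveCharacter.

Section LittleGroups.
Variables (F : finFieldType) (k : nat) (r : 'I_k.+2) (s : nat).
Hypothesis sk : (s <= k.+1)%N.
Implicit Types (M N : {'GL_k.+2[F]}) (A B : {'GL_k.+1[F]}).
Variable L : {group {'GL_k.+1[F]}}.
Local Notation U := (unitri F k).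
Hypothesis sLU : L \subset U.

Definition rowsupp (a : 'rV[F]_k.+1) :=
  [forall i : 'I_k.+1, (s <= i)%N ==> (a 0 i == 0)].

Lemma rowsuppP (a : 'rV[F]_k.+1) :
  reflect (forall i : 'I_k.+1, (s <= i)%N -> a 0 i = 0) (rowsupp a).
Proof.
apply: (iffP forallP) => [H i si|H i]; first exact/eqP/(implyP (H i)).
by apply/implyP => si; apply/eqP/H.
Qed.

Lemma card_rowsupp : #|[set a | rowsupp a]| = (#|F| ^ s)%N.
Proof.
rewrite -(card_colsupp F sk) -(card_imset _ (@trmx_inj F k.+1 1)).
apply: eq_card => a; rewrite inE; apply/idP/imsetP => [sa|[v + ->]].
  exists a^T; last by rewrite trmxK.
  by rewrite inE; apply/colsuppP => i si; rewrite mxE (rowsuppP _ sa).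
by rewrite inE => /colsuppP sv; apply/rowsuppP => i si; rewrite mxE sv.
Qed.

Let V := ('ker (delGL_morphism F r s))%G.
Let G := ext_group_group r s L.

Definition eval_col (a : 'rV[F]_k.+1) (M : {'GL_k.+2[F]}) : F :=
  (a *m delcol r (GLval M)) 0 0.

(** Additivity holds because the deletion of M fixes a on the support of
    the column of N. This is what extends the character of the column attached to
    a to the whole stabiliser of a. *)
Lemma eval_colM a : {in ext_group r s (stab s a) &,
  forall M N, eval_col a (M * N)%g = eval_col a M + eval_col a N}.
Proof.
move=> M N /(ext_groupP _ _ _ (stab_sub s a))[tM _ /stabP[_ aM]].
move=> /(ext_groupP _ _ _ (stab_sub s a))[tN /colsuppP sN _].
rewrite /eval_col GLvalM delcolM // mulmxDr mxE -delGLE // mulmxA.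
congr (_ + _); rewrite !mxE; apply: eq_bigr => j _.
by have [js|sj] := ltnP j s; [rewrite aM | rewrite sN ?mulr0].
Qed.

Lemma ker_extP M : reflect [/\ row_trivial r (GLval M),
    colsupp s (delcol r (GLval M)) & delGL r M = 1%g] (M \in V).
Proof.
apply: (iffP morphpreP) => [[/ambientP[tM sM _] /set1P d1]|[tM sM d1]] //.
split; last exact/set1P.
by apply/ambientP; rewrite d1; split=> //; exact: group1.
Qed.

Lemma ker_sub_ext (X : {group {'GL_k.+1[F]}}) : V \subset ext_group r s X.
Proof. by apply: morphpreS; rewrite sub1G. Qed.

Lemma ker_ext_normal : V <| G.
Proof. exact: ker_normal_pre. Qed.

Lemma ker_ext_abelian : abelian V.
Proof.
apply/centsP => M /ker_extP[tM sM dM] N /ker_extP[tN sN dN].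
apply: val_inj; rewrite [LHS]GLvalM [RHS]GLvalM.
apply: (del_ext (r := r)); rewrite ?row_trivialM ?delM ?delcolM //.
  by rewrite -!delGLE // dM dN.
by rewrite -!delGLE // dM dN GL_1E !mul1mx addrC.
Qed.

(** Compare the columns of the two sides of (N ^ M^-1) M = M N. *)
Lemma delcol_conj M N : M \in G -> N \in V ->
  delcol r (GLval (N ^ M^-1)%g) = GLval (delGL r M) *m delcol r (GLval N).
Proof.
move=> GM VN; have [tM _ _] := ext_groupP _ _ _ sLU GM.
have nVM : M^-1%g \in 'N(V).
  exact: subsetP (normal_norm ker_ext_normal) _ (groupVr GM).
have VN' : (N ^ M^-1)%g \in V by rewrite (memJ_norm _ nVM).
have [tN sN dN] := ker_extP _ VN; have [tN' sN' dN'] := ker_extP _ VN'.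
have : ((N ^ M^-1) * M = M * N)%g by rewrite conjgE invgK -!mulgA mulVg mulg1.
move: (N ^ M^-1)%g tN' sN' dN' => N' tN' _ dN'.
move/(congr1 (fun X : {'GL_k.+2[F]} => delcol r (GLval X))).
rewrite !GLvalM !delcolM // -!delGLE // dN' GL_1E mul1mx addrC.
by move/addrI.
Qed.

Variable p : Iirr [set: F].
Hypothesis p0 : p != 0.
Variable t : 'rV[F]_k.+1 -> Iirr V.
Hypothesis tE : forall a, {in V, forall M, 'chi_(t a) M = 'chi_p (eval_col a M)}.

Lemma additive_char_lin : 'chi_p \is a linear_char.
Proof. by apply/char_abelianP; rewrite FinRing.zmod_abelian. Qed.

Lemma additive_charM (x y : F) : 'chi_p (x + y) = 'chi_p x * 'chi_p y.
Proof. by rewrite -(lin_charM additive_char_lin) ?inE. Qed.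

Lemma ker_elt_exists (v : 'cV[F]_k.+1) : colsupp s v ->
  exists2 M, M \in V & delcol r (GLval M) = v.
Proof.
move=> sv; exists (insGL r (v, 1%g)); last by rewrite insGLE delcol_ins.
by apply/ker_extP; rewrite insGLE delcol_ins delGL_ins; split=> //; apply: ins_row_trivial.
Qed.

Lemma eval_col_inj a b :
    (forall M, M \in V -> 'chi_p (eval_col a M) = 'chi_p (eval_col b M)) ->
  forall j : 'I_k.+1, (j < s)%N -> a 0 j = b 0 j.
Proof.
move=> H j js; apply/eqP; rewrite -subr_eq0; apply/eqP.
apply: (additive_char_sep p0) => y.
have sv : colsupp s (y *: delta_mx j 0).
  apply/colsuppP => i si; rewrite !mxE; case: eqP => [eij|_]; rewrite ?mulr0 //.
  by rewrite eij leqNgt js in si.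
have [M VM DM] := ker_elt_exists sv.
have := H M VM; rewrite /eval_col DM -!scalemxAr -!colE !mxE => E.
have nz : 'chi_p (y * b 0 j) != 0 by rewrite lin_char_neq0 ?additive_char_lin ?inE.
apply: (mulIf nz); rewrite mul1r -additive_charM -E; congr ('chi_p _).
by rewrite mulrBl mulrC [b 0 j * y]mulrC subrK.
Qed.

(** By [delcol_conj], conjugation by M replaces the functional a by a times the
    deletion of M. *)
Lemma inertia_ext a : 'I_G['chi_(t a)] = ext_group r s (L :&: stab s a).
Proof.
apply/setP => M; apply/setIP/idP => [[GM]|].
  have [tM sM LM] := ext_groupP _ _ _ sLU GM.
  move=> IM; apply/(ext_groupP _ _ _ (subset_trans (subsetIl _ _) sLU)); split=> //.
  rewrite inE LM; apply/stabP; split; first exact: (subsetP sLU).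
  apply: eval_col_inj => N VN.
  have GMV : M^-1%g \in G by rewrite groupV.
  have nVM : M^-1%g \in 'N(V) by exact: (subsetP (normal_norm ker_ext_normal)).
  rewrite -(tE a VN) -[RHS](inertia_valJ _ (groupVr IM)).
  rewrite (tE a) ?memJ_norm // /eval_col delcol_conj //.
  by rewrite mulmxA.
move=> /(ext_groupP _ _ _ (subset_trans (subsetIl _ _) sLU))[tM sM].
rewrite inE => /andP[LM /stabP[UM aM]].
have GM : M \in G by apply/ext_groupP.
have nVM : M \in 'N(V) by exact: (subsetP (normal_norm ker_ext_normal)).
split=> //; rewrite inE nVM; apply/eqP/cfun_inP => N VN.
rewrite cfConjgE // (tE a) ?memJ_norm ?groupV // (tE a) //.
congr ('chi_p _); rewrite /eval_col delcol_conj // mulmxA !mxE.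
have [_ /colsuppP sN _] := ker_extP _ VN.
apply: eq_bigr => j _.
by have [js|sj] := ltnP j s; [rewrite aM | rewrite sN ?mulr0].
Qed.

(** The map from rows to characters is injective by [eval_col_inj], and there are
    q^s objects on either side. *)
Lemma pulled_chars_onto : [set t a | a in [set a | rowsupp a]] = [set: Iirr V].
Proof.
apply/eqP; rewrite eqEcard subsetT cardsT card_Iirr_abelian ?ker_ext_abelian //=.
rewrite card_in_imset ?card_rowsupp ?card_ker_delGL //.
move=> a b; rewrite !inE => sa sb eab; apply/rowP => j.
have [js|sj] := ltnP j s; last by rewrite (rowsuppP _ sa) ?(rowsuppP _ sb).
by apply: (@eval_col_inj a b) => // M VM; rewrite -!tE ?eab.
Qed.
End LittleGroups.

Lemma index_ext (F : finFieldType) k (r : 'I_k.+2) s (L H : {group {'GL_k.+1[F]}}) :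
    (s <= k.+1)%N -> L \subset unitri F k -> H \subset L ->
  #|ext_group r s L : ext_group r s H| = #|L : H|.
Proof.
move=> sk sLU sHL; have sHU := subset_trans sHL sLU.
have sE : ext_group r s H \subset ext_group r s L by apply: morphpreS.
have := Lagrange sE; rewrite -[in RHS]/(gval (ext_group_group _ _ _)).
rewrite !card_ext // -(Lagrange sHL) mulnA => /eqP.
have F0 : (0 < #|F|)%N by rewrite ltnW // card_finNzRing_gt1.
by rewrite eqn_pmul2l ?muln_gt0 ?cardG_gt0 ?expn_gt0 ?F0 // => /eqP.
Qed.

(** The little group method for a column extension: the inertia quotient attached to
    the row a is its stabiliser in L. *)
Theorem irr_count_ext (F : finFieldType) k (r : 'I_k.+2) s
    (L : {group {'GL_k.+1[F]}}) d :
    (s <= k.+1)%N -> L \subset unitri F k ->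
  (#|L| * irr_count (ext_group_group r s L) 1 d =
   \sum_(a | rowsupp s a)
     #|L :&: stab s a| * irr_count (L :&: stab s a) #|L : L :&: stab s a| d)%N.
Proof.
move=> sk sLU.
pose V := ('ker (delGL_morphism F r s))%G; pose G := ext_group_group r s L.
have [p p0] := additive_character_exists F.
have ex_t a :
    exists t : Iirr V, {in V, forall M, 'chi_t M = 'chi_p (eval_col r a M)}.
  apply: pullback_additive_char => M N VM VN.
  by apply: (@eval_colM _ _ _ s); apply: (subsetP (ker_sub_ext _ _ _)).
have [t tE] := fin_all_exists ex_t.
have ext (i : Iirr V) : exists c : Iirr 'I_G['chi_i], 'Res[V] 'chi_c = 'chi_i.
  have : i \in [set: Iirr V] by rewrite inE.
  rewrite -(pulled_chars_onto sk p0 tE) => /imsetP[a _ ->].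
  have sT : 'I_G['chi_(t a)] \subset ext_group r s (stab s a).
    by rewrite (inertia_ext sLU p0 tE) morphpreS ?subsetIr.
  have [|c Hc] := @pullback_additive_char F _ ('I_G['chi_(t a)])%G (eval_col r a) p.
    by move=> M N TM TN; apply: (@eval_colM _ _ _ s); apply: (subsetP sT).
  exists c; apply/cfun_inP => M VM.
  have sVT : V \subset 'I_G['chi_(t a)] by apply/sub_Inertia/ker_sub_ext.
  by rewrite cfResE // Hc ?(subsetP sVT) // tE.
have := little_group_count (ker_ext_normal _ _ _) (ker_ext_abelian F r s) d ext.
have inj_t : {in [set a | rowsupp s a] &, injective t}.
  apply/imset_injP; rewrite (pulled_chars_onto sk p0 tE) cardsT card_rowsupp //.
  by rewrite card_Iirr_abelian ?ker_ext_abelian // card_ker_delGL.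
have reindex_t (f : Iirr V -> nat) :
    (\sum_i f i = \sum_(a | rowsupp s a) f (t a))%N.
  transitivity (\sum_(i in [set: Iirr V]) f i)%N.
    by apply: eq_bigl => i; rewrite inE.
  rewrite -(pulled_chars_onto sk p0 tE) big_imset //=.
  by apply: eq_bigl => a; rewrite inE.
rewrite reindex_t (card_ext r sLU sk) -mulnA.
rewrite (eq_bigr (fun a => #|F| ^ s * (#|L :&: stab s a|
     * irr_count (L :&: stab s a) #|L : L :&: stab s a| d)))%N; last first.
  move=> a _; have sLa : L :&: stab s a \subset L by exact: subsetIl.
  rewrite (inertia_ext sLU p0 tE) card_ext ?(subset_trans sLa) // index_ext //.
  rewrite -mulnA; congr (_ * (_ * _))%N; apply: irr_count_isog.
  rewrite /= (inertia_ext sLU p0 tE).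
  have sD : ext_group r s (L :&: stab s a) \subset ambient F r s.
    by exact: subsetIl.
  have := first_isog_loc (delGL_morphism F r s) sD.
  rewrite (setIidPr (ker_sub_ext _ _ _)) morphpreK //.
  by apply: subset_trans (subset_trans sLa sLU) _; rewrite -(im_delGL F r s).
rewrite -big_distrr /= => /eqP.
have F0 : (0 < #|F|)%N by rewrite ltnW // card_finNzRing_gt1.
by rewrite eqn_pmul2l ?expn_gt0 ?F0 // => /eqP.
Qed.

(** * Sorting the rows by their leading coordinate *)

Section LeadingIndex.
Variables (F : finFieldType) (k s : nat).
Hypothesis sk : (s <= k.+1)%N.
Implicit Types (A B g : {'GL_k.+1[F]}) (a b : 'rV[F]_k.+1).
Local Notation U := (unitri F k).

Lemma stabZ (c : F) a : c != 0 -> stab s (c *: a) = stab s a :> {set _}.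
Proof.
move=> c0; apply/setP => A; apply/stabP/stabP => -[UA aA]; split=> // j js.
  by have := aA j js; rewrite -scalemxAl !mxE => /(mulfI c0).
by rewrite -scalemxAl mxE aA // mxE.
Qed.

Lemma stabJ_sub g a : g \in U ->
  stab s a :^ g \subset stab s (a *m (GLval g : 'M_k.+1)).
Proof.
move=> Ug; apply/subsetP => _ /imsetP[A /stabP[UA aA] ->].
apply/stabP; split; first by rewrite groupJ.
move=> j js; rewrite -mulmxA -GLvalM -conjgC GLvalM mulmxA.
exact: (unitri_trunc Ug aA).
Qed.

Lemma stabJ g a : g \in U ->
  stab s (a *m (GLval g : 'M_k.+1)) = stab s a :^ g :> {set _}.
Proof.
move=> Ug; apply/eqP; rewrite eqEsubset stabJ_sub // andbT.
rewrite -sub_conjgV; apply: subset_trans (stabJ_sub _ (groupVr Ug)) _.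
by rewrite -mulmxA -GLvalM mulgV GL_1E mulmx1.
Qed.

(** Replace row t of the identity matrix by a. *)
Lemma unitri_row_exists (t : 'I_k.+1) a : a 0 t = 1 ->
    (forall i : 'I_k.+1, (i < t)%N -> a 0 i = 0) ->
  exists2 g, g \in U & delta_mx 0 t *m (GLval g : 'M_k.+1) = a.
Proof.
move=> a1 a0.
pose X : 'M[F]_k.+1 := \matrix_(i, j) if i == t then a 0 j else (i == j)%:R.
have X0 (i j : 'I_k.+1) : (j < i)%N -> X i j = 0.
  rewrite mxE; case: eqP => [-> /a0//|_ ji].
  by rewrite -val_eqE /= gtn_eqF.
have X1 i : X i i = 1 by rewrite mxE eqxx; case: eqP => // ->.
have uX : X \in unitmx.
  rewrite -unitmx_tr unitmxE det_trig; last first.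
    by apply/is_trig_mxP => i j ij; rewrite mxE X0.
  by rewrite big1 ?unitr1 // => i _; rewrite mxE X1.
pose g : {'GL_k.+1[F]} := insubd (1%g : {'GL_k.+1[F]}) X.
have gE : GLval g = X by rewrite /g insubdK.
exists g; first by apply/unitriangularP; rewrite gE.
by rewrite gE -rowE; apply/rowP => j; rewrite !mxE eqxx.
Qed.

Definition lead (t : 'I_k.+1) a :=
  (a 0 t != 0) && [forall i : 'I_k.+1, (i < t)%N ==> (a 0 i == 0)].

Lemma leadP t a : reflect (a 0 t != 0 /\ forall i : 'I_k.+1, (i < t)%N -> a 0 i = 0)
  (lead t a).
Proof.
apply: (iffP andP) => [[nz /forallP H]|[nz H]]; split=> //.
  by move=> i it; exact/eqP/(implyP (H i)).
by apply/forallP => i; apply/implyP => it; rewrite H.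
Qed.

(** Only the coordinates strictly between t and s are free. *)
Lemma card_lead_in (t : 'I_k.+1) (C : {set F}) : (t < s)%N ->
  #|[set a : 'rV[F]_k.+1 | [&& rowsupp s a, a 0 t \in C
       & [forall i : 'I_k.+1, (i < t)%N ==> (a 0 i == 0)]]]|
  = (#|C| * #|F| ^ (s - 1 - t))%N.
Proof.
move=> ts.
pose D (i : nat) : {set F} := if (i < t)%N then [set 0] else
  if i == t then C else if (i < s)%N then setT else [set 0].
transitivity #|[set a : 'rV[F]_k.+1 | [forall i : 'I_k.+1, a 0 i \in D i]]|.
  apply: eq_card => a; rewrite !inE.
  apply/and3P/forallP => [[/rowsuppP sa Ca /forallP la] i|H].
    rewrite /D; case: ltngtP => [it|it|/val_inj->] //.
      by rewrite inE; apply: (implyP (la i)).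
    by case: ltnP => si; rewrite inE // sa.
  split.
  - apply/rowsuppP => i si; have := H i; rewrite /D ltnNge (leq_trans (ltnW ts)) //=.
    by rewrite gtn_eqF ?(leq_trans ts) // ltnNge si /= inE => /eqP.
  - by have := H t; rewrite /D ltnn eqxx.
  - by apply/forallP => i; apply/implyP => it; have := H i; rewrite /D it inE.
rewrite card_rV_family -(big_mkord xpredT (fun i => #|D i|)).
rewrite (@big_cat_nat _ _ _ t) //= ?(ltnW (ltn_ord t)) //.
rewrite (@big_cat_nat _ _ _ t.+1 t) //=.
rewrite big_nat1 (@big_cat_nat _ _ _ s t.+1) //=.
rewrite big_nat_cond big1 ?mul1n; last first.
  by move=> i /andP[/andP[_ it] _]; rewrite /D it cards1.
rewrite {1}/D ltnn eqxx; congr (_ * _)%N.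
rewrite [X in (_ * X)%N]big_nat_cond [X in (_ * X)%N]big1 ?muln1; last first.
  move=> i /andP[/andP[si _] _].
  rewrite /D ltnNge (leq_trans (ltnW ts)) //= gtn_eqF ?(leq_trans ts) //.
  by rewrite ltnNge si /= cards1.
rewrite big_nat_cond (eq_bigr (fun=> #|F|)); last first.
  move=> i /andP[/andP[ti si] _].
  by rewrite /D ltnNge (ltnW ti) /= gtn_eqF // si cardsT.
by rewrite -big_nat_cond prod_nat_const_nat subnAC subn1 subnS.
Qed.

Lemma card_lead (t : 'I_k.+1) : (t < s)%N ->
  #|[set a | rowsupp s a & lead t a]| = ((#|F| - 1) * #|F| ^ (s - 1 - t))%N.
Proof.
move=> ts; rewrite subn1 -(cardsC1 (0 : F)) -card_lead_in //.
by apply: eq_card => a; rewrite !inE.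
Qed.

Variables (L : {group {'GL_k.+1[F]}}) (d : nat).
Hypothesis sLU : L \subset U.
Hypothesis nLU : U \subset 'N(L).

Definition stab_term a : nat :=
  (#|L :&: stab s a| * irr_count (L :&: stab s a) #|L : L :&: stab s a| d)%N.

Lemma stab_termE a (X : {group {'GL_k.+1[F]}}) g :
  g \in U -> L :&: stab s a = X :^ g -> X \subset L ->
  stab_term a = (#|X| * irr_count X #|L : X| d)%N.
Proof.
move=> Ug eX sXL; have cE : #|L :&: stab s a| = #|X| by rewrite eX cardJg.
rewrite /stab_term cE; congr (_ * _)%N.
have -> : #|L : L :&: stab s a| = #|L : X|.
  by rewrite -!divgS ?subsetIl //= cE.
apply: irr_count_isog; rewrite /= eX isog_sym.
exact: conj_isog.
Qed.

Lemma stab_term0 : stab_term 0 = (#|L| * irr_count L 1 d)%N.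
Proof.
rewrite (@stab_termE _ L _ (group1 U)) ?indexgg //.
rewrite conjsg1.
apply/setIidPl/(subset_trans sLU)/subsetP => A UA; apply/stabP; split=> // j _.
by rewrite mul0mx mxE.
Qed.

(** The row a is a scalar multiple of e_t g with g unitriangular, and g normalises L,
    so that the two stabilisers in L are conjugate. *)
Lemma stab_term_lead t a : lead t a -> stab_term a = stab_term (delta_mx 0 t).
Proof.
move=> /leadP[nz la].
have [||g Ug Dg] := @unitri_row_exists t ((a 0 t)^-1 *: a).
- by rewrite mxE mulVf.
- by move=> i it; rewrite mxE (la i it) mulr0.
rewrite (@stab_termE a (L :&: stab s (delta_mx 0 t))%G g) ?subsetIl //=.
have c0 : (a 0 t)^-1 != 0 by rewrite invr_eq0.
by rewrite conjIg (normsP nLU _ Ug) -(stabJ _ Ug) Dg (stabZ _ c0).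
Qed.

Lemma sum_stab_term :
  (\sum_(a | rowsupp s a) stab_term a = #|L| * irr_count L 1 d
   + \sum_(t < k.+1 | t < s)
       (#|F| - 1) * #|F| ^ (s - 1 - t) * stab_term (delta_mx 0%R t))%N.
Proof.
rewrite (bigD1 0) /=; last by apply/rowsuppP => i _; rewrite mxE.
rewrite stab_term0; congr (_ + _)%N.
transitivity (\sum_(a | rowsupp s a && (a != 0%R))
    \sum_(t < k.+1 | (t < s)%N && lead t a) stab_term a)%N.
  apply: eq_bigr => a /andP[/rowsuppP sa a0].
  have /existsP[i0 nz0] : [exists i, a 0 i != 0].
    apply: contraR a0 => /existsPn H; apply/eqP/rowP => i; rewrite mxE.
    by apply/eqP; have := H i; rewrite negbK.
  pose t := [arg min_(i < i0 | a 0 i != 0) (i : nat)].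
  have [nzt mint] : a 0 t != 0 /\ forall i, a 0 i != 0 -> (t <= i)%N.
    by rewrite /t; case: arg_minnP.
  rewrite (big_pred1 t) // => i /=.
  apply/andP/eqP => [[si /leadP[nz la]]|->].
    apply: val_inj; apply/eqP; rewrite /= eqn_leq mint // andbT leqNgt.
    by apply: contra nzt => ti; rewrite la.
  split; first by rewrite ltnNge; apply: contra nzt => st; rewrite sa.
  apply/leadP; split=> // j jt; apply/eqP; apply: contraLR jt => nzj.
  by rewrite -leqNgt mint.
rewrite (exchange_big_dep (fun t : 'I_k.+1 => (t < s)%N)) /=; last first.
  by move=> a t _ /andP[].
apply: eq_bigr => t ts.
rewrite (eq_bigr (fun=> stab_term (delta_mx 0 t))); last first.
  by move=> a /andP[_ /andP[_ /stab_term_lead]].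
rewrite sum_nat_const -(card_lead ts); congr (_ * _)%N; apply: eq_card => a.
rewrite !inE ts /= unfold_in /= andbAC; apply: andb_idr => /andP[_ /leadP[nz _]].
by apply: contra nz => /eqP->; rewrite mxE.
Qed.
End LeadingIndex.

Section StabIndex.
Variables (F : finFieldType) (k s : nat) (t : 'I_k.+1).
Hypothesis (ts : (t < s)%N) (sk : (s <= k.+1)%N).
Local Notation U := (unitri F k).

(** The orbit of e_t, truncated at s, consists of the rows with leading coefficient
    1 in position t; the fibres of A |-> e_t A are the cosets of the stabiliser. *)
Lemma index_stab :
  #|U : stab s (delta_mx 0 t : 'rV[F]_k.+1)| = (#|F| ^ (s - 1 - t))%N.
Proof.
pose e : 'rV[F]_k.+1 := delta_mx 0 t.
pose S := [set a : 'rV[F]_k.+1 | [&& rowsupp s a, lead t a & a 0 t == 1]].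
pose f (A : {'GL_k.+1[F]}) : 'rV[F]_k.+1 :=
  \row_j (if (j < s)%N then (e *m (GLval A : 'M_k.+1)) 0 j else 0).
have sU : stab s e \subset U := stab_sub s e.
have cS : #|S| = (#|F| ^ (s - 1 - t))%N.
  have := card_lead_in sk [set 1 : F] ts; rewrite cards1 mul1n => <-.
  apply: eq_card => a; rewrite !inE; congr (_ && _); rewrite andbAC; congr (_ && _).
  by apply: andb_idl => /eqP->; rewrite oner_eq0.
have eE (A : {'GL_k.+1[F]}) j : (e *m (GLval A : 'M_k.+1)) 0 j = GLval A t j.
  by rewrite /e -rowE mxE.
have fS A : A \in U -> f A \in S.
  move=> UA; have [tA dA] := unitriangularP _ UA.
  rewrite inE; apply/and3P; split.
  - by apply/rowsuppP => j sj; rewrite mxE ltnNge sj.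
  - apply/leadP; rewrite mxE ts eE dA oner_eq0; split=> // j jt.
    by rewrite mxE eE tA // if_same.
  - by rewrite mxE ts eE dA.
have fib a : a \in S -> #|[set A in U | f A == a]| = #|stab s e|.
  rewrite inE => /and3P[/rowsuppP sa /leadP[_ la] /eqP a1].
  have [g Ug Dg] := unitri_row_exists a1 la.
  rewrite -[RHS](card_rcoset _ g); apply: eq_card => A; rewrite mem_rcoset.
  apply/setIdP/stabP => [[UA /eqP Da]|[UAg H]].
    split=> [|j js]; first exact: groupM UA (groupVr Ug).
    have E : forall j : 'I_k.+1, (j < s)%N ->
        (e *m (GLval A : 'M_k.+1)) 0 j = (e *m (GLval g : 'M_k.+1)) 0 j.
      by move=> i si; rewrite Dg -Da [RHS]mxE si.
    rewrite GLvalM mulmxA (unitri_trunc (groupVr Ug) E js).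
    by rewrite -mulmxA -GLvalM mulgV GL_1E mulmx1.
  have UA : A \in U by rewrite -(groupMr _ (groupVr Ug)).
  split=> //; apply/eqP/rowP => j; rewrite mxE; case: ltnP => [js|sj].
    have := unitri_trunc Ug H js.
    by rewrite -mulmxA -GLvalM mulgKV Dg.
  by rewrite sa.
rewrite -divgS // -cS -[#|U|]sum1_card (partition_big f (mem S)) //=.
rewrite (eq_bigr (fun=> #|stab s e|)) ?sum_nat_const ?mulnK //.
move=> a Sa; rewrite -(fib a Sa) -sum1_card; apply: eq_bigl => A.
by rewrite [RHS]in_set.
Qed.
End StabIndex.

(** * Recognising column extensions and bounding their degrees *)

Section Identify.
Variable (F : finFieldType).

(** Fixing e_t means having a trivial row t. Column t is then nonzero above the
    diagonal only, that is in t free positions. *)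
Lemma stab_basis_row_ext k (t : 'I_k.+2) :
  stab k.+2 (basis_row t : 'rV[F]_k.+2) = ext_group t t (unitri F k) :> {set _}.
Proof.
apply/setP => A; apply/stabP/ext_groupP => //.
- case=> /unitriangularP[tA dA] H.
  have tr : row_trivial t (GLval A).
    apply/row_trivialP => j; have := H j (ltn_ord j).
    by rewrite -rowE !mxE eqxx.
  split=> //.
    by apply/colsuppP => i ti; rewrite !mxE tA //= /bump ti.
  apply/unitriangularP; rewrite delGLE //; split=> [i j ij|i]; rewrite !mxE ?dA //.
  by rewrite tA //= ltnNge leq_bump2 -ltnNge.
- case=> tr /colsuppP sA /unitriangularP[]; rewrite delGLE // => tD dD.
  move/row_trivialP: tr => tr; split; last first.
    by move=> j _; rewrite -rowE !mxE tr eqxx eq_sym.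
  apply/unitriangularP; split=> [i j|i].
    case: (unliftP t i) => [i'|] ->; last by move=> lt; rewrite tr -val_eqE /= ltn_eqF.
    case: (unliftP t j) => [j'|] -> lt.
      have := tD i' j'; rewrite !mxE; apply.
      by rewrite ltnNge -(leq_bump2 t) -ltnNge.
    have := sA i'; rewrite !mxE; apply.
    by move: lt; rewrite /= /bump; case: leqP => //= a b; lia.
  case: (unliftP t i) => [i'|] ->; last by rewrite tr eqxx.
  by have := dD i'; rewrite !mxE.
Qed.

Lemma unitri_ext k :
  unitri F k.+1 = ext_group ord_max k.+1 (unitri F k) :> {set _}.
Proof.
rewrite -[k.+1 in X in _ = X]/(nat_of_ord (@ord_max k.+1)) -stab_basis_row_ext.
apply/eqP; rewrite eqEsubset stab_sub andbT; apply/subsetP => A UA.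
have [tA dA] := unitriangularP _ UA.
apply/stabP; split=> // j _; rewrite -rowE !mxE eqxx /=.
have [->|nj] := eqVneq j ord_max; first by rewrite dA.
by rewrite tA // ltn_neqAle -ltnS ltn_ord andbT.
Qed.

Lemma ext_sub k (r : 'I_k.+2) s s' (L L' : {group {'GL_k.+1[F]}}) :
    L' \subset unitri F k -> L \subset L' -> (s <= s')%N ->
  ext_group r s L \subset ext_group r s' L'.
Proof.
move=> sLU' sL ss; have sLU := subset_trans sL sLU'.
apply/subsetP => M /(ext_groupP _ _ _ sLU)[tM /colsuppP sM LM].
apply/ext_groupP => //; split=> //; last exact: (subsetP sL).
by apply/colsuppP => i si; rewrite sM // (leq_trans ss).
Qed.

(* abelian subgroups *)

(** Equivalently, the columns supported on the first a coordinates are fixed. The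
    condition on the entries is the one that passes to column extensions. *)
Definition fixes_first k (a : nat) (A : {group {'GL_k.+1[F]}}) :=
  forall M : {'GL_k.+1[F]}, M \in A ->
  forall i j : 'I_k.+1, (j < a)%N -> GLval M i j = (i == j)%:R.

Lemma fixes_firstP k a (A : {group {'GL_k.+1[F]}}) M (v : 'cV[F]_k.+1) :
  fixes_first a A -> M \in A -> colsupp a v -> (GLval M : 'M_k.+1) *m v = v.
Proof.
move=> fA AM /colsuppP sv; apply/colP => i; rewrite mxE (bigD1 i) //= big1.
  have [ia|ai] := ltnP i a; first by rewrite fA // eqxx mul1r addr0.
  by rewrite sv // mulr0 addr0.
move=> j ji; have [ja|aj] := ltnP j a; last by rewrite sv // mulr0.
by rewrite fA // eq_sym (negPf ji) mul0r.
Qed.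

(** An abelian group that acts trivially on the column commutes with it. *)
Lemma ext_abelian k (r : 'I_k.+2) a s (A : {group {'GL_k.+1[F]}}) :
    A \subset unitri F k -> abelian A -> fixes_first a A -> (s <= a)%N ->
  abelian (ext_group r s A).
Proof.
move=> sAU abA fA sa; apply/centsP => M + N.
move=> /(ext_groupP _ _ _ sAU)[tM sM AM] /(ext_groupP _ _ _ sAU)[tN sN AN].
have mono v : colsupp s v -> colsupp a v :> bool.
  by move=> /colsuppP H; apply/colsuppP => i ai; rewrite H // (leq_trans sa).
apply: val_inj; rewrite [LHS]GLvalM [RHS]GLvalM.
apply: (del_ext (r := r)); rewrite ?row_trivialM ?delM ?delcolM //.
  by rewrite -!delGLE // -!GLvalM (centsP abA).
by rewrite -!delGLE // !(fixes_firstP fA) ?mono // addrC.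
Qed.

Lemma index_ext_pow k (r : 'I_k.+2) s s' (L L' : {group {'GL_k.+1[F]}}) x :
    L' \subset unitri F k -> L \subset L' -> (s <= s')%N -> (s' <= k.+1)%N ->
    #|L' : L| = (#|F| ^ x)%N ->
  #|ext_group r s' L' : ext_group r s L| = (#|F| ^ (s' - s + x))%N.
Proof.
move=> sLU' sL ss sk idx; have sLU := subset_trans sL sLU'.
have F0 : (0 < #|F|)%N by rewrite ltnW // card_finNzRing_gt1.
apply/eqP; rewrite -(@eqn_pmul2l #|ext_group r s L|) ?cardG_gt0 //.
rewrite Lagrange ?ext_sub // !card_ext // ?(leq_trans ss) //.
by rewrite -(Lagrange sL) idx expnD mulnACA -expnD subnKC.
Qed.

Lemma card_unitri k : #|unitri F k| = (#|F| ^ 'C(k.+1, 2))%N.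
Proof.
elim: k => [|k IH].
  rewrite -[RHS](cards1 (1%g : {'GL_1[F]})); congr #|pred_of_set _|.
  apply/eqP; rewrite eqEsubset sub1G andbT; apply/subsetP => A UA.
  have [_ dA] := unitriangularP _ UA.
  apply/set1P/val_inj/matrixP => i j.
  by rewrite ord1 [j]ord1 [LHS]dA [RHS]mxE eqxx.
by rewrite unitri_ext card_ext // IH -expnD [in RHS]binS bin1 addnC.
Qed.

(** The block of the first a + 1 rows and the last b columns, built one column at a
    time starting from the trivial subgroup of U_(a+1): each new column of
    height a + 1 is fixed by the block obtained so far. *)
Lemma unitri_abelian_subgroup a b : exists A : {group {'GL_(a + b).+1[F]}},
  [/\ A \subset unitri F (a + b), abelian A, fixes_first a.+1 A
    & #|unitri F (a + b) : A| = (#|F| ^ ('C(a.+1, 2) + 'C(b, 2)))%N].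
Proof.
elim: b => [|b [A [sAU abA fA idx]]].
  rewrite addn0; exists 1%G; rewrite sub1G abelian1 indexg1 card_unitri addn0; split=> //.
  by move=> M /set1P-> i j _; rewrite GL_1E mxE.
rewrite addnS; exists (ext_group_group ord_max a.+1 A).
have ab : (a < (a + b).+1)%N by rewrite ltnS leq_addr.
split.
- by rewrite unitri_ext /= ext_sub.
- exact: ext_abelian fA _.
- move=> M /(ext_groupP _ _ _ sAU)[/row_trivialP tM sM AM] i j ja.
  case: (unliftP ord_max i) => [i'|] ->; last by rewrite tM eq_sym.
  case: (unliftP ord_max j) ja => [j'|] -> ja; last first.
    by move: ja; rewrite /= ltnNge ab.
  rewrite (inj_eq lift_inj) -(fA _ AM i' j').
    by rewrite delGLE ?mxE //; apply/row_trivialP.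
  by move: ja; rewrite lift_max.
rewrite unitri_ext /= (@index_ext_pow _ _ _ _ _ _ _ _ sAU _ _ idx) //.
have -> : 'C(b.+1, 2) = ('C(b, 2) + b)%N by rewrite binS bin1.
congr (_ ^ _)%N; lia.
Qed.

(** For n = a + 1 + b with a + 1 = ceil(n/2), mu n is the number of positions above
    the diagonal outside the block of a + 1 rows and b columns. *)
Lemma mu_halves k : exists a b, k = (a + b)%N /\ a.+1 = uphalf k.+1 /\
   mu k.+1 = ('C(a.+1, 2) + 'C(b, 2))%N.
Proof.
have bin2D m : ('C(m.+1, 2) = m + 'C(m, 2))%N by rewrite binS bin1 addnC.
have bin2_double m : (2 * 'C(m, 2) = m * (m - 1))%N.
  elim: m => // m IH; rewrite bin2D mulnDr IH.
  by case: m {IH} => [|m]; rewrite !subn1 /=; nia.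
exists k./2, (uphalf k); split.
  by have := odd_double_half k; have := uphalf_half k; lia.
split=> //; rewrite /mu /= -[X in (X ^ 2)%N]/(uphalf k) uphalf_half.
move: (k./2) (bin2_double k./2) => m Hm; case: (odd k) => /=.
  by rewrite add1n bin2D; nia.
by rewrite add0n bin2D; nia.
Qed.

(** The abelian block in U_(k+1) has at least c rows, so it fixes the first c entries
    of the column, and together with them forms an abelian subgroup. The
    remaining s - c entries of the column increase the index. *)
Lemma degrees_le_ext k (r : 'I_k.+2) s c :
    (c <= s)%N -> (s <= k.+1)%N -> (c <= uphalf k.+1)%N ->
  degrees_le (ext_group_group r s (unitri F k)) (#|F| ^ (mu k.+1 + (s - c))).
Proof.
move=> cs sk; have [a [b [Dk [<- ->]]]] := mu_halves k; subst k => ca.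
have [A [sAU abA fA idx]] := unitri_abelian_subgroup a b.
rewrite [(_ + (s - c))%N]addnC -(index_ext_pow r _ sAU cs sk idx) //.
apply: degrees_le_index_abelian; first by rewrite ext_sub.
exact: ext_abelian fA _.
Qed.
End Identify.

(** * The counting theorem for normal subgroups of the unitriangular group *)

Lemma eq_irr_count (gT : finGroupType) (G H : {group gT}) c d :
  G = H :> {set gT} -> irr_count G c d = irr_count H c d.
Proof. by move/group_inj->. Qed.

Section Layers.
Variable F : finFieldType.
Local Notation q := #|F|.

Lemma q_gt0 : (0 < q)%N.
Proof. by rewrite ltnW // card_finNzRing_gt1. Qed.
Lemma q_gt1 : (1 < q)%N.
Proof. exact: card_finNzRing_gt1. Qed.

Lemma sum_ord_inord n m (f : 'I_n.+1 -> nat) : (m <= n.+1)%N ->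
  (\sum_(t < n.+1 | t < m) f t = \sum_(t < m) f (inord t))%N.
Proof.
move=> mn; rewrite (big_ord_widen _ (fun t => f (inord t)) mn).
by apply: eq_bigr => t _; rewrite inord_val.
Qed.

(** For each t < s there are (q - 1) q^(s-1-t) rows with leading coordinate t, and
    all of them contribute the same term as e_t. *)
Lemma irr_count_ext_lead k (r : 'I_k.+2) s (L : {group {'GL_k.+1[F]}}) d :
    (s <= k.+1)%N -> L \subset unitri F k -> unitri F k \subset 'N(L) ->
  (#|L| * irr_count (ext_group_group r s L) 1 d =
   #|L| * irr_count L 1 d
   + \sum_(t < s) (q - 1) * q ^ (s - 1 - t) *
        stab_term s L d (basis_row (inord t)))%N.
Proof.
move=> sk sLU nLU; rewrite irr_count_ext // -[LHS]/(\sum_(a | _) stab_term s L d a)%N.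
rewrite sum_stab_term //; congr (_ + _)%N; rewrite sum_ord_inord //.
by apply: eq_bigr => t _; rewrite inordK // (leq_trans (ltn_ord t)).
Qed.

Lemma stab_term_sub_eq k s (L X : {group {'GL_k.+1[F]}}) d a :
  L :&: stab s a = X -> stab_term s L d a = (#|X| * irr_count X #|L : X| d)%N.
Proof.
move=> eX; apply: (@stab_termE _ _ _ _ _ _ _ 1%g); rewrite ?group1 ?conjsg1 //.
by rewrite -eX subsetIl.
Qed.

(** For L = U_(k+1) the orbit of e_t has length q^(s-1-t), which cancels the number
    of rows up to the scalars. *)
Lemma irr_count_ext_unitri k (r : 'I_k.+2) s d : (s <= k.+1)%N ->
  (irr_count (ext_group_group r s (unitri F k)) 1 d =
   irr_count (unitri F k) 1 d
   + (q - 1) * \sum_(t < s)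
        irr_count (stab s (basis_row (inord t) : 'rV[F]_k.+1)) (q ^ (s - 1 - t)) d)%N.
Proof.
move=> sk; apply/eqP; rewrite -(@eqn_pmul2l #|unitri F k|) ?cardG_gt0 //.
rewrite irr_count_ext_lead ?normG // mulnDr mulnCA big_distrr big_distrr /=.
apply/eqP; congr (_ + _)%N; apply: eq_bigr => t _.
have tk : (inord t : 'I_k.+1) = t :> nat.
  by rewrite inordK // (leq_trans (ltn_ord t)).
rewrite (stab_term_sub_eq _ (setIidPr (stab_sub _ _))).
rewrite index_stab ?tk // -(Lagrange (stab_sub s (basis_row (inord t : 'I_k.+1)))).
by rewrite index_stab ?tk // -!mulnA; congr (_ * _)%N; rewrite mulnCA.
Qed.

Lemma irr_count_ext0 k (r : 'I_k.+2) (L : {group {'GL_k.+1[F]}}) d :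
    L \subset unitri F k -> unitri F k \subset 'N(L) ->
  irr_count (ext_group_group r 0 L) 1 d = irr_count L 1 d.
Proof.
move=> sLU nLU; apply/eqP; rewrite -(@eqn_pmul2l #|L|) ?cardG_gt0 //.
by rewrite irr_count_ext_lead // big_ord0 addn0.
Qed.

Lemma stab_basis_row_unitri k s (t : 'I_k.+1) : (s <= t.+1)%N ->
  stab s (basis_row t : 'rV[F]_k.+1) = unitri F k :> {set _}.
Proof.
move=> st; apply/eqP; rewrite eqEsubset stab_sub; apply/subsetP => A UA.
have [tA dA] := unitriangularP _ UA.
apply/stabP; split=> // j js; rewrite -rowE !mxE eqxx /=.
have [->|nj] := eqVneq j t; first by rewrite dA.
by rewrite tA // ltn_neqAle nj -ltnS (leq_trans js).
Qed.

(** Both the zero row and e_0 are stabilised by the whole unitriangular group. *)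
Lemma irr_count_ext1 k (r : 'I_k.+2) d :
  irr_count (ext_group_group r 1 (unitri F k)) 1 d =
  (q * irr_count (unitri F k) 1 d)%N.
Proof.
rewrite irr_count_ext_unitri // big_ord1 (eq_irr_count _ _ (stab_basis_row_unitri _)) //.
by rewrite -{1}[irr_count _ _ _]mul1n -mulnDl subnKC ?q_gt0.
Qed.

(** By [unitri_no01P], for size at least 2 these are the unitriangular matrices
    whose entry (0, 1) vanishes. *)
Definition unitri_no01 k := stab 2 (basis_row ord0 : 'rV[F]_k.+1).

Definition ord_one {k} : 'I_k.+2 := lift ord0 ord0.

(** If a_0 = 1, the first two coordinates of a A are 1 and A_01 + a_1. *)
Lemma unitri_no01P k (a : 'rV[F]_k.+2) A : a 0 ord0 = 1 ->
  reflect (A \in unitri F k.+1 /\ GLval A ord0 ord_one = 0) (A \in stab 2 a).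
Proof.
move=> a1.
have mulE (B : {'GL_k.+2[F]}) (j : 'I_k.+2) : B \in unitri F k.+1 -> (j < 2)%N ->
    (a *m GLval B) 0 j = GLval B ord0 j + a 0 ord_one * GLval B ord_one j.
  move=> /unitriangularP[tB _] j2.
  rewrite mxE big_ord_recl a1 mul1r; congr (_ + _).
  rewrite big_ord_recl big1 ?addr0 // => i _.
  by rewrite tB ?mulr0 //; apply: leq_trans j2 _.
apply: (iffP (stabP _ _ _)) => -[UA H]; split=> //; have [tA dA] := unitriangularP _ UA.
  have := H ord_one isT; rewrite mulE // dA mulr1 -[RHS]add0r.
  exact: addIr.
move=> j j2; rewrite mulE //.
have [->|->] : j = ord0 \/ j = ord_one.
- by case: j j2 => [[|[|j]] lt] // _; [left|right]; apply: val_inj.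
- by rewrite dA tA // mulr0 addr0.
by rewrite H dA mulr1 add0r.
Qed.

(** The orbit of e_0 consists of rows with first coordinate 1, which by
    [unitri_no01P] all have the same stabiliser. *)
Lemma unitri_no01_normal k : unitri F k.+1 \subset 'N(unitri_no01 k.+1).
Proof.
apply/normsP => g Ug; rewrite -stabJ //.
have [_ dg] := unitriangularP _ Ug.
have h1 : ((basis_row ord0 : 'rV_k.+2) *m (GLval g : 'M[F]_k.+2)) 0 ord0 = 1.
  by rewrite -rowE mxE dg.
have h0 : (basis_row ord0 : 'rV[F]_k.+2) 0 ord0 = 1 by rewrite mxE eqxx.
by apply/setP => A; apply/(unitri_no01P A h1)/(unitri_no01P A h0).
Qed.

Lemma unitri_no01_sub k : unitri_no01 k \subset unitri F k.
Proof. exact: stab_sub. Qed.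

(** The zero row and the row e_1 are stabilised by the whole group, and together
    they contribute 1 + (q - 1) = q times its count. The orbit of e_0 has length
    q, with stabiliser given by the vanishing of the entry (0, 1). *)
Lemma irr_count_ext2 k (r : 'I_k.+3) d :
  irr_count (ext_group_group r 2 (unitri F k.+1)) 1 d =
  (q * irr_count (unitri F k.+1) 1 d + (q - 1) * irr_count (unitri_no01 k.+1) q d)%N.
Proof.
rewrite irr_count_ext_unitri // big_ord_recl big_ord1 /=.
rewrite (_ : inord 0 = ord0); last by apply: val_inj; rewrite /= inordK.
have -> : irr_count (stab 2 (basis_row (inord (bump 0 0)) : 'rV[F]_k.+2))
    (q ^ (2 - 1 - bump 0 0)) d = irr_count (unitri F k.+1) 1 d.
  by apply: eq_irr_count; apply: stab_basis_row_unitri; rewrite inordK.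
rewrite expn1 -/(unitri_no01 k.+1) mulnDr [(_ * irr_count (unitri F _) _ _)%N]mulnBl mul1n.
by rewrite addnCA subnKC ?leq_pmull ?q_gt0 // addnC.
Qed.

Lemma unitri_no01_ext k :
  unitri_no01 k.+2 = ext_group ord_max k.+2 (unitri_no01 k.+1) :> {set _}.
Proof.
have e0 : lift ord_max ord0 = ord0 :> 'I_k.+3 by apply: val_inj.
have e1 : lift ord_max ord_one = ord_one :> 'I_k.+3 by apply: val_inj.
have h2 n : (basis_row ord0 : 'rV[F]_n.+2) 0 ord0 = 1 by rewrite mxE eqxx.
apply/setP => A; apply/(unitri_no01P A (h2 _))/(ext_groupP _ _ _ (unitri_no01_sub _)).
  rewrite unitri_ext => -[/(ext_groupP _ _ _ (subxx _))[tA sA UA] A0].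
  split=> //; apply/(unitri_no01P _ (h2 _)); split=> //.
  by rewrite delGLE // !mxE e0 e1.
case=> tA sA /(unitri_no01P _ (h2 _))[UA].
rewrite delGLE // !mxE e0 e1; split=> //.
by rewrite unitri_ext; apply/ext_groupP.
Qed.

Lemma index_unitri_no01 k : #|unitri F k.+1 : unitri_no01 k.+1| = q.
Proof. by rewrite index_stab. Qed.

Lemma unitri_no01_stab0 k :
  unitri_no01 k.+1 :&: stab k.+2 (basis_row ord0) = ext_group ord0 0 (unitri F k).
Proof.
rewrite stab_basis_row_ext; apply/setIidPr; rewrite -stab_basis_row_ext.
by apply/subsetP => A /stabP[UA H]; apply/stabP; split=> // j _; apply: H.
Qed.

(** Row 1 is trivial and column 1 has the single entry (0, 1) above the diagonal,
    which is required to vanish: nothing remains of the column. *)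
Lemma unitri_no01_stab1 k :
  unitri_no01 k.+1 :&: stab k.+2 (basis_row ord_one) =
  ext_group ord_one 0 (unitri F k).
Proof.
have e0 : lift ord_one ord0 = ord0 :> 'I_k.+2 by apply: val_inj.
have h2 : (basis_row ord0 : 'rV[F]_k.+2) 0 ord0 = 1 by rewrite mxE eqxx.
apply/setP => A; rewrite inE stab_basis_row_ext; apply/andP/ext_groupP => //.
  case=> /(unitri_no01P _ h2)[UA A0].
  move=> /(ext_groupP _ _ _ (subxx _))[tA /colsuppP sA dA]; split=> //.
  apply/colsuppP => i _; have [i0|i1] := posnP i; last exact: sA.
  by rewrite !mxE (_ : i = ord0) ?e0 //; apply: val_inj.
case=> tA /colsuppP sA dA.
have EA : A \in ext_group ord_one 1 (unitri F k).
  by apply/ext_groupP => //; split=> //; apply/colsuppP => i _; apply: sA.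
split=> //; apply/(unitri_no01P _ h2); split.
  by move: EA; rewrite -stab_basis_row_ext; apply: (subsetP (stab_sub _ _)).
by have := sA ord0 isT; rewrite !mxE e0.
Qed.

Lemma muSS n : mu n.+3 = (mu n.+1 + n.+1)%N.
Proof.
rewrite /mu /= !negbK; have := odd_double_half n; have := uphalf_half n.
by case: (odd n) => /=; move: (n./2) (uphalf n) => x y; nia.
Qed.

(** * Characters of large degree *)

(** For t > j, [degrees_le_ext] with c = j + 1 bounds the exponent of the degrees of
    the stabiliser of e_t by mu (n - 2) + t - (j + 1), where n = k + 3. The
    orbit length adds n - 2 - t, and the sum is mu n - (j + 1). The zero row has
    stabiliser U_(n-1), an extension of U_(n-2) by a column of height n - 2, and
    the same bound excludes it. *)
Lemma irr_count_top k j : (j < uphalf k.+1)%N ->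
  irr_count (unitri F k.+2) 1 (q ^ (mu k.+3 - j)) =
  ((q - 1) * \sum_(t < j.+1)
     irr_count (ext_group_group (inord t) t (unitri F k))
       (q ^ (k.+1 - t)) (q ^ (mu k.+3 - j)))%N.
Proof.
move=> ju.
have jk : (j < k.+1)%N.
  by move: ju; rewrite uphalf_half; have := odd_double_half k.+1; lia.
rewrite (eq_irr_count _ _ (unitri_ext _ _)) irr_count_ext_unitri //.
rewrite (eq_irr_count _ _ (unitri_ext _ _)).
rewrite (irr_count_eq0 (@degrees_le_ext F k ord_max k.+1 j.+1 jk (leqnn _) ju)) ?add0n; last first.
  by rewrite muln1 ltn_exp2l ?q_gt1 // muSS; lia.
congr (_ * _)%N; rewrite (big_ord_widen k.+2 (fun t =>
  irr_count (ext_group_group (inord t) t (unitri F k))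
    (q ^ (k.+1 - t)) (q ^ (mu k.+3 - j)))%N); last by lia.
rewrite [RHS]big_mkcond /=; apply: eq_bigr => t _; rewrite subn1 /=.
have -> : irr_count (stab k.+2 (basis_row (inord t : 'I_k.+2) : 'rV[F]_k.+2))
    (q ^ (k.+1 - t)) (q ^ (mu k.+3 - j)) =
  irr_count (ext_group_group (inord t) t (unitri F k))
    (q ^ (k.+1 - t)) (q ^ (mu k.+3 - j)).
  by apply: eq_irr_count; rewrite stab_basis_row_ext inordK.
case: ltnP => // jt.
have tk : (t <= k.+1)%N by rewrite -ltnS.
rewrite (irr_count_eq0 (@degrees_le_ext F k (inord t) t j.+1 jt tk ju)) //.
rewrite -expnD ltn_exp2l ?q_gt1 // muSS; have := ltn_ord t; lia.
Qed.

Lemma irr_count_shift (gT : finGroupType) (G : {group gT}) a b e : e = (b + a)%N ->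
  irr_count G (q ^ a) (q ^ e) = irr_count G 1 (q ^ b).
Proof. by move=> ->; rewrite expnD irr_countM // expn_gt0 q_gt0. Qed.

End Layers.

Section Top.
Variable F : finFieldType.
Local Notation q := #|F|.

(** Put m = k + 3 and let L be the group of matrices of size m - 1 with vanishing
    entry (0, 1), so that the one of size m extends L by a column. The
    stabilisers of e_0 and e_1 in L are both isomorphic to U_(m-2), and both
    orbits have length q^(m-3): that of e_0 is shortened because the entry
    (0, 1) vanishes. On the other hand e_0 is the leading row of q times as many
    rows as e_1. This gives q (q - 1) + (q - 1). The other rows are excluded by
    [degrees_le_ext] with c = 2. *)
Lemma irr_count_unitri_no01 k : (1 < uphalf k.+1)%N ->
  irr_count (unitri_no01 F k.+2) 1 (q ^ (mu k.+3 - 1)) =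
  ((q - 1) * (q + 1) * irr_count (unitri F k) 1 (q ^ mu k.+1))%N.
Proof.
move=> u1; have k0 : (1 < k.+1)%N.
  by move: u1; rewrite uphalf_half; have := odd_double_half k.+1; lia.
set d := (q ^ _)%N; set N := irr_count (unitri F k) 1 _.
have sLU := unitri_no01_sub F k.+1; have nLU := @unitri_no01_normal F k.
have dE : d = (q ^ (mu k.+1 + k))%N by rewrite /d muSS; congr (_ ^ _)%N; lia.
have cL : #|unitri_no01 F k.+1| = (q ^ k * #|unitri F k|)%N.
  apply/eqP; rewrite -(@eqn_pmul2r q) ?q_gt0 // -{1}(index_unitri_no01 F k) Lagrange //.
  by rewrite unitri_ext card_ext // expnS -mulnA mulnC.
have small (X : {group {'GL_k.+2[F]}}) (r : 'I_k.+2) s c :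
    X \subset ext_group r s (unitri F k) -> (1 < s)%N -> (s <= k.+1)%N ->
    (c <= q ^ (k.+1 - s))%N -> irr_count X c d = 0%N.
  move=> sX s1 sk cle.
  apply: irr_count_eq0 (degrees_le_sub sX (@degrees_le_ext F k r s 2 s1 sk u1)) _.
  apply: leq_ltn_trans (leq_mul (leqnn _) cle) _.
  by rewrite -expnD dE ltn_exp2l ?q_gt1 //; lia.
have indexle (S : {group {'GL_k.+2[F]}}) :
    (#|unitri_no01 F k.+1 : unitri_no01 F k.+1 :&: S| <= #|unitri F k.+1 : S|)%N.
  by rewrite indexgI; apply/subset_leq_card/imsetS.
have big_term (t r : 'I_k.+2) :
    unitri_no01 F k.+1 :&: stab k.+2 (basis_row t) = ext_group r 0 (unitri F k) ->
  stab_term k.+2 (unitri_no01 F k.+1) d (basis_row t) = (#|unitri F k| * N)%N.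
  move=> eX; rewrite (@stab_term_sub_eq _ _ _ _ (ext_group_group r 0 (unitri F k))) //.
  rewrite card_ext // expn0 mul1n; congr (_ * _)%N.
  have -> : #|unitri_no01 F k.+1 : ext_group r 0 (unitri F k)| = (q ^ k)%N.
    apply/eqP; rewrite -(@eqn_pmul2l #|unitri F k|) ?cardG_gt0 //.
    have sE : ext_group_group r 0 (unitri F k) \subset unitri_no01 F k.+1.
      by rewrite /= -eX subsetIl.
    by have := Lagrange sE; rewrite card_ext // expn0 mul1n cL => ->; rewrite mulnC.
  by rewrite dE (@irr_count_shift _ _ _ _ (mu k.+1)) // irr_count_ext0 ?normG.
apply/eqP; rewrite -(@eqn_pmul2l #|unitri_no01 F k.+1|) ?cardG_gt0 //.
rewrite (eq_irr_count _ _ (unitri_no01_ext F k)) irr_count_ext_lead //.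
rewrite (@small _ ord_max k.+1) ?unitri_ext ?subnn // -?unitri_ext // muln0 add0n.
rewrite cL big_ord_recl big_ord_recl big1 ?addn0 /=; last first.
  move=> t _; set u := basis_row _.
  rewrite /stab_term (@small _ (inord t.+2) t.+2) ?muln0 //.
  - by rewrite subIset // stab_basis_row_ext inordK ?subxx ?orbT // !ltnS.
  - by rewrite !ltnS; have := ltn_ord t; lia.
  - apply: leq_trans (indexle _) _; rewrite index_stab //.
    by rewrite inordK // !ltnS.
rewrite (_ : inord 0 = ord0); last by apply: val_inj; rewrite /= inordK.
rewrite (_ : inord (bump 0 0) = ord_one); last by apply: val_inj; rewrite /= inordK.
(* t = 0 has weight (q - 1) q^(k+1) and t = 1 has weight (q - 1) q^k, while the
   stabilisers of both have index q^k in L. *)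
rewrite (big_term _ ord0) ?unitri_no01_stab0 // (big_term _ ord_one) ?unitri_no01_stab1 //.
rewrite subn0 !subn1 /= expnS.
have [x ->] : exists x, q = x.+1 by exists q.-1; rewrite prednK ?q_gt0.
by apply/eqP; move: (x.+1 ^ k)%N #|unitri F k| => y z; rewrite /=; nia.
Qed.

Lemma num_irrE k e : num_irr k.+1 e F = irr_count (unitri F k) 1 (q ^ e).
Proof. by apply: eq_card => i; rewrite !inE mulr1. Qed.

End Top.

Local Open Scope nat_scope.

Theorem theorem1p2 (F : finFieldType) (q : nat) (hq : #|F| = q) :
  [/\ forall n : nat, 3 <= n ->
        num_irr n (mu n) F = (q - 1) * num_irr (n - 2) (mu (n - 2)) F,
      forall n : nat, 5 <= n ->
        num_irr n (mu n - 1) F =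
          (q - 1) * num_irr (n - 2) (mu (n - 2) - 1) F
          + q * (q - 1) ^ 2 * num_irr (n - 4) (mu (n - 4)) F
    & forall n : nat, 7 <= n ->
        num_irr n (mu n - 2) F =
          (q - 1) * num_irr (n - 2) (mu (n - 2) - 2) F
          + q * (q - 1) ^ 2 * num_irr (n - 4) (mu (n - 4) - 1) F
          + (2 * q ^ 2 + q - 1) * (q - 1) ^ 3
            * num_irr (n - 6) (mu (n - 6)) F].
Proof.
have normU k : unitri F k \subset 'N(unitri F k) by exact: normG.
have q0 := q_gt0 F.
have mu3 k : mu k.+3 = mu k.+1 + k.+1 := muSS k.
have part1 k : num_irr k.+3 (mu k.+3) F = (q - 1) * num_irr k.+1 (mu k.+1) F.
  rewrite !num_irrE -hq -[mu k.+3]subn0 irr_count_top // big_ord1.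
  by rewrite !subn0 (@irr_count_shift _ _ _ _ (mu k.+1)) ?mu3 // irr_count_ext0.
have part2 k : num_irr k.+4.+1 (mu k.+4.+1 - 1) F =
    (q - 1) * num_irr k.+3 (mu k.+3 - 1) F
    + q * (q - 1) ^ 2 * num_irr k.+1 (mu k.+1) F.
  have -> : q * (q - 1) ^ 2 * num_irr k.+1 (mu k.+1) F =
    (q - 1) * (q * num_irr k.+3 (mu k.+3) F) by rewrite part1; lia.
  rewrite !num_irrE -hq irr_count_top // -mulnDr big_ord_recr big_ord1 /=.
  congr (_ * (_ + _)).
    rewrite (@irr_count_shift _ _ _ _ (mu k.+3 - 1)) ?irr_count_ext0 //.
    by rewrite !mu3; lia.
  rewrite (@irr_count_shift _ _ _ _ (mu k.+3)) ?irr_count_ext1 //.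
  by rewrite !mu3; lia.
split=> [[|[|[|k]]]|[|[|[|[|[|k]]]]]|[|[|[|[|[|[|[|k]]]]]]]] // _.
rewrite !subSS !subn0.
have -> : (2 * q ^ 2 + q - 1) * (q - 1) ^ 3 * num_irr k.+1 (mu k.+1) F =
   (q - 1) * (q * (q * (q - 1) ^ 2 * num_irr k.+1 (mu k.+1) F)
     + (q * num_irr k.+4.+1 (mu k.+4.+1) F
        + (q - 1) * ((q - 1) * (q + 1) * num_irr k.+3 (mu k.+3) F))).
  (* (q - 1)^3 (q^2 + q + (q - 1)(q + 1)) is the coefficient in (iii): the three
     summands come from t = 1 through (ii), from the factor q for t = 2, and from
     the matrices with vanishing entry (0, 1). *)
  rewrite !part1; have [x ->] : exists x, q = x.+1 by exists (q - 1); lia.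
  by rewrite subn1 /=; nia.
have -> : q * (q - 1) ^ 2 * num_irr k.+3 (mu k.+3 - 1) F =
  (q - 1) * (q * ((q - 1) * num_irr k.+3 (mu k.+3 - 1) F)) by lia.
rewrite -addnA -!mulnDr [X in _ * (_ + X)]addnA -mulnDr -part2.
rewrite !num_irrE -hq irr_count_top // !big_ord_recr big_ord0 /= add0n -addnA.
congr (_ * (_ + (_ + _))).
- rewrite (@irr_count_shift _ _ _ _ (mu k.+4.+1 - 2)) ?irr_count_ext0 //.
  by rewrite !mu3; lia.
- rewrite (@irr_count_shift _ _ _ _ (mu k.+4.+1 - 1)) ?irr_count_ext1 //.
  by rewrite !mu3; lia.
rewrite (@irr_count_shift _ _ _ _ (mu k.+4.+1)) ?irr_count_ext2; last first.
  by rewrite !mu3; lia.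
congr (_ + _ * _); rewrite -irr_count_unitri_no01 //.
rewrite -[X in irr_count _ X]expn1.
by rewrite (@irr_count_shift _ _ _ _ (mu k.+4.+1 - 1)) // !mu3; lia.
Qed.
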